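(* Let $\mathfrak{M}\subseteq\mathbb{R}^n$ be a nonempty closed set and let $\ell\in C(\mathbb{R}^n)$ be bounded, with $\ell(x)>0$ for $x\in\mathbb{R}^n\setminus\mathfrak{M}$ and $\ell\equiv0$ on $\mathfrak{M}$. Then for every $x\in\mathbb{R}^n$ there exists an optimal control $\alpha^*$ for the problem $$v(x)=\inf_\alpha\int_0^{t_x(\alpha)}\ell(y_x^\alpha(s))\,ds,$$ that is, an admissible control $\alpha^*$ with $\int_0^{t_x(\alpha^* )}\ell(y_x^{\alpha^*}(s))\,ds=v(x)$.
   Context: An admissible control is a measurable function $\alpha:[0,+\infty)\to B(0,1)$, where $B(0,1)$ is the closed unit ball of $\mathbb{R}^n$ (i.e. $|\alpha(s)|\le1$). Its trajectory from $x$ is $y_x^\alpha(t)=x+\int_0^t\alpha(s)\,ds$, and its hitting time is $t_x(\alpha)=\inf\{s\ge0: y_x^\alpha(s)\in\mathfrak{M}\}\in[0,+\infty]$ (with $\inf\emptyset=+\infty$). The infimum defining $v(x)$ is over all admissible controls. *)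

(* Defs.v *)
From HB Require Import structures.
From mathcomp Require Import all_boot all_order all_algebra.
From mathcomp Require Import all_classical all_reals all_analysis.

Set Implicit Arguments.
Unset Strict Implicit.
Unset Printing Implicit Defensive.

Import Order.TTheory GRing.Theory Num.Theory.
Import numFieldNormedType.Exports.

Local Open Scope classical_set_scope.
Local Open Scope ring_scope.

(* [measurableTypeR R] carries the Borel sigma-algebra; controls are Lebesgue
   measurable, so the time line carries the domain of
   [completed_lebesgue_measure] instead. *)
Notation lebesgueType R := (caratheodory_type (@wlength R idfun)^*%mu).

Notation borelRV R n := (g_sigma_algebraType (@open 'rV[R]_n)).

(* The norm [`|x|] of ['rV[R]_n] in MathComp-Analysis is the sup norm, hence
   this definition; both norms induce the topology of ['rV[R]_n]. *)
Definition euclidean_norm (R : realType) (n : nat) (x : 'rV[R]_n) : R :=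
  Num.sqrt (\sum_(i < n) x ord0 i ^+ 2).

(* Only the values of [alpha] on [0, +oo[ matter: neither this predicate nor
   the definitions below depend on the others. *)
Definition admissible (R : realType) (n : nat) (alpha : R -> 'rV[R]_n) : Prop :=
  measurable_fun (`[0, +oo[ : set (lebesgueType R))
    (alpha : lebesgueType R -> borelRV R n) /\
  (forall s : R, 0 <= s -> euclidean_norm (alpha s) <= 1).

Definition trajectory (R : realType) (n : nat) (x : 'rV[R]_n)
    (alpha : R -> 'rV[R]_n) (t : R) : 'rV[R]_n :=
  x + \row_(i < n)
        Rintegral (@completed_lebesgue_measure R) `[0, t]
          (fun s => alpha s ord0 i).

Definition hitting_time (R : realType) (n : nat) (M : set 'rV[R]_n)
    (x : 'rV[R]_n) (alpha : R -> 'rV[R]_n) : \bar R :=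
  ereal_inf [set s%:E | s in [set s : R | 0 <= s /\ M (trajectory x alpha s)]].

Definition cost (R : realType) (n : nat) (M : set 'rV[R]_n)
    (ell : 'rV[R]_n -> R) (x : 'rV[R]_n) (alpha : R -> 'rV[R]_n) : \bar R :=
  (\int[@completed_lebesgue_measure R]_(s in
       [set s : R | (0 <= s)%R /\ s%:E <= hitting_time M x alpha])
     (ell (trajectory x alpha s))%:E)%E.

Definition value (R : realType) (n : nat) (M : set 'rV[R]_n)
    (ell : 'rV[R]_n -> R) (x : 'rV[R]_n) : \bar R :=
  ereal_inf [set cost M ell x alpha | alpha in @admissible R n].

(* Main.v *)
Require Import Defs.
From HB Require Import structures.
From mathcomp Require Import all_boot all_order all_algebra.
From mathcomp Require Import all_classical all_reals all_analysis.
From mathcomp Require Import measurable_realfun ring lra.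

(** Take controls whose costs tend to the value.  Their trajectories are
    1-Lipschitz paths issued from [x], so Tychonoff's theorem and the common
    Lipschitz bound give a subsequence converging pointwise to a 1-Lipschitz
    path [y].  As [M] is closed, the hitting time is lower semicontinuous along
    this convergence, and Fatou's lemma shows that the cost of [y] is at most the
    value, whether the hitting times stay bounded or not.

    It remains to see that [y] is a trajectory.  For a real 1-Lipschitz [g], the
    Lebesgue-Stieltjes measure of the nondecreasing function [(g t + t) / 2] is
    dominated by Lebesgue measure; its Radon-Nikodym density and Lebesgue
    differentiation make [g] differentiable almost everywhere and equal to the
    integral of its derivative.  The velocity of [y] is then the control, with
    Euclidean norm at most 1 as a limit of difference quotients. *)

Set Implicit Arguments.
Unset Strict Implicit.
Unset Printing Implicit Defensive.

Import Order.TTheory GRing.Theory Num.Theory.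
Import numFieldNormedType.Exports.

Local Open Scope classical_set_scope.
Local Open Scope ring_scope.

(** * Lipschitz functions are integrals of their derivatives *)

(** Both sides are infima over countable covers by half-open intervals, so it is enough to compare
    increments cover by cover. Hence [A] may be any set. *)
Lemma le_lebesgue_stieltjes_measure (R : realType) (F G : cumulative R R) :
  (forall a b, a <= b -> F b - F a <= G b - G a) ->
  forall A, (lebesgue_stieltjes_measure F A <= lebesgue_stieltjes_measure G A)%E.
Proof.
move=> FG A; apply/le_ereal_inf_tmp => _ [B [mB AB] <-].
apply: (@le_trans _ _ (\sum_(k <oo) wlength F (B k))%E).
  by apply: ereal_inf_lbound; exists B.
apply: lee_nneseries => [k _ _|k _]; first exact: wlength_ge0.
have [[a b] _ <-] := mB k; have [ab|ba] := leP a b.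
  have E (H : cumulative R R) : wlength H `]a, b]%classic = (H b - H a)%:E.
    exact: wlength_itv_bnd.
  suff : (wlength F `]a, b]%classic <= wlength G `]a, b]%classic)%E by [].
  by rewrite (E F) (E G) lee_fin FG.
rewrite set_itv_ge; last by rewrite bnd_simp -leNgt ltW.
suff : (wlength F set0 <= wlength G set0)%E by [].
by rewrite !wlength0.
Qed.

Lemma lebesgue_stieltjes_measure_itv_oc (R : realType) (F : cumulative R R) (a b : R) :
  a <= b -> lebesgue_stieltjes_measure F `]a, b]%classic = (F b - F a)%:E.
Proof.
move=> ab; rewrite /lebesgue_stieltjes_measure /measure_extension.
rewrite measurable_mu_extE; last exact: is_ocitv.
exact: wlength_itv_bnd.
Qed.

Lemma lipschitz1_continuous (R : realType) (g : R -> R) :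
  (forall s t, `|g s - g t| <= `|s - t|) -> continuous g.
Proof.
move=> g1 x; apply/cvgrPdist_le => e e0; near=> t.
by rewrite (le_trans (g1 _ _))//; near: t; exact: cvgr_dist_le.
Unshelve. all: by end_near. Qed.

(** If [f] is the density of the Stieltjes measure of [F t = (g t + t) / 2], then [2 * f - 1] is
    that of [g], since [g t = 2 * F t - t]. The bound [N] makes the measures finite. *)
Lemma lipschitz1_density (R : realType) (g : R -> R) (N : R) :
  (forall s t, `|g s - g t| <= `|s - t|) ->
  exists f : R -> R, [/\ (@lebesgue_measure R).-integrable setT (EFin \o f)
   & forall t : R, 0 <= t <= N ->
     \int[lebesgue_measure]_(s in `[0, t]) f s = g t - g 0].
Proof.
move=> g1; pose F t := (g t + t) / 2.
have F_nd : {homo F : x y / x <= y}.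
  move=> a b ab; have := g1 b a.
  rewrite (ger0_norm (_ : 0 <= b - a)) ?subr_ge0// => /ler_normlP[].
  rewrite /F; lra.
have F_rc : right_continuous F.
  apply: right_continuousW => x; apply: cvgMl.
  by apply: cvgD; [exact: lipschitz1_continuous|exact: cvg_id].
pose Fmix := isCumulative.Build R _ R F F_nd F_rc.
pose Fc : cumulative R R := HB.pack F Fmix.
pose LS := lebesgue_stieltjes_measure Fc.
(* Increments of [F] are at most those of the identity, by the upper Lipschitz bound; the lower one
   made [F] nondecreasing. *)
have LSle A : (LS A <= lebesgue_measure A)%E.
  apply: (@le_lebesgue_stieltjes_measure _ Fc) => a b ab /=.
  have := g1 b a; rewrite (ger0_norm (_ : 0 <= b - a)) ?subr_ge0// => /ler_normlP[].
  rewrite /F; lra.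
have mD : measurable (`]0, N] : set (measurableTypeR R)) by [].
have LSD : (LS `]0%R, N]%classic < +oo)%E.
  apply: le_lt_trans (LSle _) _.
  by rewrite lebesgue_measure_itv; case: ifPn => //; rewrite ?ltry.
pose nu : {finite_measure set _ -> \bar R} := mfrestr mD LSD.
have nuleb : nu `<< lebesgue_measure.
  apply/null_content_dominatesP => A mA A0; apply/eqP.
  rewrite -measure_le0 /nu /= /mfrestr /mrestr -[leRHS]A0.
  apply: le_trans (LSle _) _; rewrite le_measure ?inE//.
  exact: measurableI.
have [f [f0 ffin fi fE]] := radon_nikodym_sigma_finite nuleb.
have fineE : EFin \o (fine \o f) = f by apply/funext => s /=; rewrite fineK.
pose h s := 2 * fine (f s) - 1.
have i1 (t : R) : lebesgue_measure.-integrable `[0, t] (EFin \o cst (1 : R)).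
  apply: continuous_compact_integrable; first exact: segment_compact.
  exact/continuous_subspaceT/cst_continuous.
have if_ t : lebesgue_measure.-integrable `[0, t] (EFin \o (fine \o f)).
  by rewrite fineE; apply: integrableS fi.
have i2f t : lebesgue_measure.-integrable `[0, t] (EFin \o (fun s => 2 * fine (f s))).
  rewrite (_ : EFin \o _ = (fun s => 2%:E * (EFin \o (fine \o f)) s)%E).
    exact: integrableZl.
  by apply/funext => s /=; rewrite EFinM.
have intf (t : R) : 0 <= t <= N ->
    \int[lebesgue_measure]_(s in `[0, t]) fine (f s) = F t - F 0.
  move=> /andP[t0 tN]; rewrite -Rintegral_itv_obnd_cbnd; last first.
    by apply: integrableS (if_ t) => //; exact: subset_itv_oc_cc.
  rewrite /Rintegral; under eq_integral do rewrite fineK//.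
  rewrite -fE// /nu /= /mfrestr /mrestr setIidl; last first.
    by apply: subset_itvl; rewrite bnd_simp.
  by rewrite lebesgue_stieltjes_measure_itv_oc.
(* The cut-off outside [[0, N]] is for integrability: the term -1 in [h] is not integrable on the
   whole line. *)
exists (h \_ `[0, N]); split.
  rewrite -restrict_EFin -integrable_mkcond//.
  rewrite (_ : EFin \o h = (fun s => (2 * fine (f s))%:E - 1%:E)%E).
    by apply: integrableB.
  by apply/funext => s /=; rewrite EFinB.
move=> t /andP[t0 tN]; rewrite -Rintegral_mkcondr setIidl; last first.
  by apply: subset_itvl; rewrite bnd_simp.
rewrite RintegralB//.
rewrite RintegralZl//.
rewrite intf ?t0// Rintegral_cst//.
have mt : fine (lebesgue_measure (`[0, t]%classic : set R)) = t.
  rewrite lebesgue_measure_itv/= lte_fin.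
  by case: ltgtP t0 => //= _ _; rewrite subr0.
transitivity (2 * (F t - F 0) - 1 * t); last by rewrite /F; lra.
congr (_ - 1 * _); exact: mt.
Qed.

Lemma lipschitz1_derive_density (R : realType) (g : R -> R) (N : R) :
  (forall s t, `|g s - g t| <= `|s - t|) ->
  exists f : R -> R, [/\ (@lebesgue_measure R).-integrable setT (EFin \o f),
   forall t : R, 0 <= t <= N ->
     \int[lebesgue_measure]_(s in `[0, t]) f s = g t - g 0
   & {ae lebesgue_measure, forall x : R, 0 < x < N -> is_derive x 1 g (f x)}].
Proof.
move=> g1; have [f [fi fE]] := lipschitz1_density N g1.
exists f; split => //.
have locf : locally_integrable [set: R] f.
  by apply: open_integrable_locally => //; exact: openT.
have fiS (y : R) : lebesgue_measure.-integrable
    [set` Interval (BLeft 0) (BRight y)] (EFin \o f).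
  exact: integrableS fi.
have := FTC1 fiS locf.
apply: filterS; first exact: (ae_filter_ringOfSetsType lebesgue_measure).
move=> x Dx /andP[x0 xN].
pose G (y : R) := \int[lebesgue_measure]_(t in `[0, y]) f t.
have [dG GE] : derivable G x 1 /\ G^`()%classic x = f x by apply: Dx; rewrite lte_fin.
have dGg : is_derive x 1 (fun y => G y + cst (g 0) y) (f x).
  rewrite -[f x]addr0; apply: is_deriveD.
  exact: (DeriveDef dG (etrans (esym (derive1E G x)) GE)).
(* As [x] lies in the open interval, [g] and [G + g 0] agree on a whole neighbourhood of [x]. *)
apply: near_eq_is_derive dGg.
near=> y; rewrite /G fE ?subrK//.
by apply/andP; split; near: y; [exact: lt_le_nbhsr|exact: lt_le_nbhsl].
Unshelve. all: by end_near. Qed.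

(** * Passing from Borel sets to the completed Lebesgue measure *)

Lemma measurable_lebesgueType (R : realType) (A : set R) :
  measurable (A : set (measurableTypeR R)) -> measurable (A : set (lebesgueType R)).
Proof. by move=> mA; apply: sub_caratheodory. Qed.

Lemma measurable_id_lebesgueType (R : realType) :
  measurable_fun setT (id : lebesgueType R -> measurableTypeR R).
Proof. by move=> _ Y mY; rewrite setTI; exact: measurable_lebesgueType. Qed.

Lemma measurable_fun_lebesgueType (R : realType) d (T : measurableType d)
    (f : R -> T) (D : set (lebesgueType R)) :
  measurable_fun setT (f : measurableTypeR R -> T) ->
  measurable D ->
  measurable_fun D (f : lebesgueType R -> T).
Proof.
move=> mf mD _ Y mY; apply: measurableI; first exact: mD.
by apply: measurable_lebesgueType; rewrite -[X in measurable X]setTI; exact: mf.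
Qed.

(** The identity is measurable from the Lebesgue to the Borel sigma-algebra and pushes the completed
    measure forward to Lebesgue measure, so this is a change of variables. *)
Lemma completed_integral (R : realType) (A : set R) (f : measurableTypeR R -> \bar R) :
  measurable (A : set (measurableTypeR R)) ->
  (@lebesgue_measure R).-integrable setT f ->
  (\int[@completed_lebesgue_measure R]_(x in A) f x =
   \int[@lebesgue_measure R]_(x in A) f x)%E.
Proof.
move=> mA fi.
have mid := @measurable_id_lebesgueType R.
have mf : measurable_fun setT f by exact: measurable_int fi.
have mf' : measurable_fun setT (f \o (id : lebesgueType R -> _)).
  exact: measurableT_comp mf mid.
have /integrableP[_ fi'] := fi.
have fi2 : (@completed_lebesgue_measure R).-integrable setT (f \o id).
  apply/integrableP; split => //.
  have := @ge0_integral_pushforward _ _ _ _ _ _ mid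
    (@completed_lebesgue_measure R) setT (abse \o f).
  rewrite preimage_setT => /(_ measurableT) <-//.
    by apply: measurableT_comp.
  by move=> y _; exact: abse_ge0.
have := @integral_pushforward _ _ _ _ _ _ mid (@completed_lebesgue_measure R) A f mf.
move=> pushE; apply/esym/pushE => //.
apply: integrableS fi2 => //; exact: measurable_lebesgueType.
Qed.

Lemma completed_ae (R : realType) (P : R -> Prop) :
  {ae @lebesgue_measure R, forall x, P x} ->
  {ae @completed_lebesgue_measure R, forall x, P x}.
Proof.
by move=> [A [mA A0 PA]]; exists A; split => //; exact: measurable_lebesgueType.
Qed.

(** * Measurability of vector-valued functions *)

Lemma measurable_coord (R : realType) (n : nat) (i : 'I_n) :
  measurable_fun setT ((fun v => v ord0 i) : borelRV R n -> R).
Proof.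
apply: (measurability _ (RGenOpens.measurableE R)) => _ [_ [a [b ->]] <-].
rewrite setTI; apply: sub_sigma_algebra.
by apply: open_comp => // v _; exact: coord_continuous.
Qed.

(** Boxes with rational centre and radius [1 / (k + 1)] form a countable base, which reduces Borel
    measurability to coordinates. *)
Lemma rV_open_bigcup (R : realType) (n : nat) (U : set 'rV[R]_n) : open U ->
  let B (p : 'rV[rat]_n * nat) :=
    [set v : 'rV[R]_n | forall i, `|v ord0 i - ratr (p.1 ord0 i)| < p.2.+1%:R^-1] in
  U = \bigcup_(p in [set p | B p `<=` U]) B p.
Proof.
move=> oU B; apply/seteqP; split => [v Uv|v [p BU]]; last exact: BU.
have /nbhs_ballP[e /= e0 eU] : nbhs v U by exact: open_nbhs_nbhs.
(* Two points of a box are each within one radius of its centre, hence less than [e] apart. *)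
have [k ke] : exists k : nat, k.+1%:R^-1 < e / 2.
  have [k _ /(_ k (leqnn k))] := near_infty_natSinv_lt (PosNum (divr_gt0 e0 (ltr0n R 2))).
  by exists k.
have qP i : exists q : rat, `|v ord0 i - ratr q| < k.+1%:R^-1.
  have [|q] := @rat_in_itvoo R (v ord0 i - k.+1%:R^-1) (v ord0 i + k.+1%:R^-1).
    by rewrite ltrD2l gtrN// invr_gt0.
  by rewrite in_itv/= => vq; exists q; rewrite distrC ltr_distl.
have [q qE] := choice qP.
exists (\row_i q i, k) => [w Bw|i] /=; last by rewrite mxE.
apply: eU; split=> // j i; rewrite (ord1 j).
have := qE i; have := Bw i; rewrite /= mxE => wq vq.
rewrite /ball /= (le_lt_trans (ler_distD (ratr (q i)) _ _))//.
rewrite [e]splitr ltrD//; first exact: lt_trans vq ke.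
by rewrite distrC; exact: lt_trans wq ke.
Qed.

Lemma measurable_fun_rV d (T : measurableType d) (R : realType) (n : nat)
    (D : set T) (a : T -> 'rV[R]_n) : measurable D ->
  (forall i, measurable_fun D (fun s => a s ord0 i)) ->
  measurable_fun D (a : T -> borelRV R n).
Proof.
move=> mD ma; apply: measurability => // _ [U oU <-].
rewrite (rV_open_bigcup oU) preimage_bigcup setI_bigcupr.
rewrite bigcup_mkcond.
apply: countable_bigcupT_measurable => [|p]; first exact: countableP.
case: ifP => // _.
(* The inner [D] matches the measurability of each coordinate on [D]; the outer one is for [n = 0],
   where the intersection is the full set. *)
rewrite (_ : _ `&` _ = D `&` \bigcap_(i : 'I_n) (D `&`
    (fun s => a s ord0 i) @^-1` (ball (ratr (p.1 ord0 i) : R) p.2.+1%:R^-1))).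
  apply: measurableI => //.
  apply: fin_bigcap_measurable => [|i _]; first exact: finite_finset.
  by apply: ma => //; exact: measurable_ball.
apply/seteqP; split=> s /= [Ds sP]; split => // i.
  by split=> //; rewrite /= /ball/= distrC.
by have [_] := sP i Logic.I; rewrite /= /ball/= distrC.
Qed.

(** * Lipschitz paths are trajectories *)

(** The Lipschitz condition for the Euclidean norm, squared to avoid roots, and required at negative
    times too. *)
Definition lipschitz1_path (R : realType) (n : nat) (y : R -> 'rV[R]_n) : Prop :=
  forall s t, \sum_(i < n) (y t ord0 i - y s ord0 i) ^+ 2 <= (t - s) ^+ 2.

Lemma lipschitz1_path_coord (R : realType) (n : nat) (y : R -> 'rV[R]_n) :
  lipschitz1_path y ->
  forall i s t, `|y s ord0 i - y t ord0 i| <= `|s - t|.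
Proof.
move=> y1 i s t; rewrite -ler_sqr ?nnegrE// !real_normK ?num_real//.
apply: le_trans (y1 t s).
by rewrite (bigD1 i)//= lerDl sumr_ge0// => j _; exact: sqr_ge0.
Qed.

Lemma cvg_sum_sqr (R : realType) (n : nat) (T : Type) (F : set_system T)
    (f : 'I_n -> T -> R) (l : 'I_n -> R) : Filter F ->
  (forall i, f i x @[x --> F] --> l i) ->
  \sum_(i < n) f i x ^+ 2 @[x --> F] --> \sum_(i < n) l i ^+ 2.
Proof.
move=> FF fl; apply: cvg_big => [|i _]; first exact: add_continuous.
by rewrite expr2; under eq_fun do rewrite expr2; exact: cvgM.
Qed.

(** Difference quotients at [h != 0] have squared Euclidean norm at most 1, a bound that survives in
    the limit. *)
Lemma lipschitz1_path_is_derive (R : realType) (n : nat) (y : R -> 'rV[R]_n)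
    (s : R) (v : 'I_n -> R) :
  lipschitz1_path y -> (forall i, is_derive s 1 (fun t => y t ord0 i) (v i)) ->
  \sum_(i < n) v i ^+ 2 <= 1.
Proof.
move=> y1 yv.
have : \sum_(i < n) (h^-1 *: (y (h *: 1 + s) ord0 i - y s ord0 i)) ^+ 2 @[h --> (0:R)^'] -->
    \sum_(i < n) v i ^+ 2.
  apply: cvg_sum_sqr => i.
  have [/cvg_ex[l yl] <-] := yv i.
  by rewrite /derive (cvg_lim _ yl).
move=> /cvgr_to_le; apply; near=> h.
have h0 : h != 0 by near: h; exact: nbhs_dnbhs_neq.
under eq_bigr do rewrite exprMn.
rewrite -mulr_sumr -ler_pdivlMl ?invr_gt0 ?exprn_even_gt0//= ?invr_eq0//.
by rewrite mulr1 -exprVn invrK (le_trans (y1 _ _))// [_%:A]mulr1 addrK.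
Unshelve. all: by end_near. Qed.


(* The default value 0 on the null set where [y] is not differentiable keeps
   the Euclidean norm below 1 everywhere. *)
Definition path_velocity (R : realType) (n : nat) (y : R -> 'rV[R]_n) (s : R) :
    'rV[R]_n :=
  if `[< forall i, derivable (fun t => y t ord0 i) s 1 >]
  then \row_i 'D_1 (fun t => y t ord0 i) s else 0.

Lemma euclidean_norm_path_velocity (R : realType) (n : nat) (y : R -> 'rV[R]_n) s :
  lipschitz1_path y -> euclidean_norm (path_velocity y s) <= 1.
Proof.
move=> y1; rewrite /euclidean_norm -[leRHS]sqrtr1 ler_wsqrtr// /path_velocity.
case: asboolP => [dy|_].
  under eq_bigr do rewrite mxE.
  by apply: (lipschitz1_path_is_derive y1) => i; exact: derivableP.
by rewrite big1// => i _; rewrite mxE expr0n.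
Qed.

Lemma path_velocity_density (R : realType) (n : nat) (y : R -> 'rV[R]_n)
    (i : 'I_n) (N : R) : lipschitz1_path y ->
  exists f : R -> R, [/\ (@lebesgue_measure R).-integrable setT (EFin \o f),
    forall t : R, 0 <= t <= N ->
      \int[lebesgue_measure]_(s in `[0, t]) f s = y t ord0 i - y 0 ord0 i
   & ae_eq (@completed_lebesgue_measure R) `[0, N[%classic
      (EFin \o f) (fun s => (path_velocity y s ord0 i)%:E)].
Proof.
move=> y1.
have [F FP] := choice (fun j => lipschitz1_derive_density N (lipschitz1_path_coord y1 j)).
exists (F i); have [Fi FE _] := FP i; split => //.
apply: completed_ae.
(* Derivatives are only known on the open interval, so the endpoint 0 is discarded as a null set. *)
have mu0 : {ae @lebesgue_measure R, forall x : R, x != 0}.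
  exists [set 0]; split => //; first exact: lebesgue_measure_set1.
  by move=> x /= /negP; rewrite negbK => /eqP.
(* [path_velocity] tests all coordinates at once, so the finitely many exceptional null sets are
   joined. *)
have : {ae @lebesgue_measure R, forall (x : R) (j : 'I_n), 0 < x < N ->
    is_derive x 1 (fun t => y t ord0 j) (F j x)}.
  by apply: filter_forall => j; have [] := FP j.
move: mu0; apply: filterS2; first exact: (ae_filter_ringOfSetsType lebesgue_measure).
move=> x x0 xF /=; rewrite in_itv/= le_eqVlt eq_sym (negbTE x0)/= => xN.
rewrite /path_velocity asboolT ?mxE; last by move=> j; have [] := xF j xN.
by have [_ <-] := xF i xN.
Qed.

(* Only Lebesgue measurability is available here: the velocity agrees almost
   everywhere with a Borel density, and the completed measure is complete. *)
Lemma measurable_path_velocity (R : realType) (n : nat) (y : R -> 'rV[R]_n) (i : 'I_n) :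
  lipschitz1_path y ->
  measurable_fun (`[0, +oo[ : set (lebesgueType R))
    ((fun s => path_velocity y s ord0 i) : lebesgueType R -> R).
Proof.
move=> y1.
rewrite (_ : `[0, +oo[%classic = \bigcup_(k : nat) `[0, k%:R[%classic :> set R); last first.
  apply/seteqP; split => [s /=|s [k _]]; rewrite /= !in_itv/= ?andbT.
    by move=> s0; exists (Num.bound s) => //=; rewrite in_itv/= s0 archi_boundP.
  by case/andP.
apply/measurable_fun_bigcup => [k|k]; first exact: measurable_lebesgueType.
apply/measurable_EFinP.
have [f [fi _ fv]] := path_velocity_density i k%:R y1.
apply: (ae_measurable_fun (@completed_lebesgue_measure_is_complete R) fv).
apply: (measurable_fun_lebesgueType (measurable_int _ fi)).
exact: measurable_lebesgueType.
Qed.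

Lemma lipschitz1_path_trajectory (R : realType) (n : nat) (y : R -> 'rV[R]_n) :
  lipschitz1_path y ->
  admissible (path_velocity y) /\
  forall t : R, 0 <= t -> trajectory (y 0) (path_velocity y) t = y t.
Proof.
move=> y1; split; [split|].
- apply: measurable_fun_rV => [|i]; first exact: measurable_lebesgueType.
  exact: measurable_path_velocity.
- by move=> s _; exact: euclidean_norm_path_velocity.
move=> t t0; apply/rowP => i; rewrite !mxE.
(* The density agrees with the velocity on a half-open interval; the horizon [t + 1] makes it
   contain [t]. *)
have [f [fi fE fv]] := path_velocity_density i (t + 1) y1.
have mt : measurable (`[0, t] : set (lebesgueType R)) by exact: measurable_lebesgueType.
have sub : `[0, t] `<=` `[0, t + 1[%classic by apply: subset_itvl; rewrite bnd_simp ltrDl.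
rewrite [X in _ + X](_ : _ = y t ord0 i - y 0 ord0 i); last first.
  have tt1 : 0 <= t <= t + 1 by rewrite t0 lerDl ler01.
  rewrite -(fE _ tt1) /Rintegral; congr fine.
  rewrite -completed_integral//; apply/esym; apply: ae_eq_integral.
  - exact: mt.
  - exact: (measurable_fun_lebesgueType (measurable_int _ fi)).
  - apply/measurable_EFinP; apply: measurable_funS (measurable_path_velocity i y1) => //.
      exact: measurable_lebesgueType.
    by apply: subset_itvl.
  - have [A [mA A0 fvA]] := fv; exists A; split => // s ns.
    by apply: fvA => fvs; apply: ns => /sub; exact: fvs.
by rewrite addrC subrK.
Qed.

(** * Trajectories are Lipschitz paths *)

Section IntegralUnitBall.
Context d (T : measurableType d) (R : realType) (mu : {measure set T -> \bar R}).
Variables (n : nat) (D : set T) (f : 'I_n -> T -> R).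
Hypotheses (mD : measurable D) (muD : (mu D < +oo)%E)
  (mf : forall i, measurable_fun D (f i))
  (f1 : forall s, D s -> \sum_(i < n) f i s ^+ 2 <= 1).

Lemma unit_ball_integrable_sqr i : mu.-integrable D (EFin \o (fun s => f i s ^+ 2)).
Proof.
apply: measurable_bounded_integrable => //; first exact: measurable_funX.
exists 1; split => // M M1 s Ds /=; rewrite ger0_norm ?sqr_ge0//.
apply: le_trans (ltW M1); apply: le_trans (f1 Ds).
by rewrite (bigD1 i)//= lerDl sumr_ge0// => j _; exact: sqr_ge0.
Qed.

Lemma unit_ball_integrable i : mu.-integrable D (EFin \o f i).
Proof.
apply: measurable_bounded_integrable => //.
exists 1; split => // M M1 s Ds /=; apply: le_trans (ltW M1).
rewrite -(@expr_le1 _ 2)// real_normK ?num_real//; apply: le_trans (f1 Ds).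
by rewrite (bigD1 i)//= lerDl sumr_ge0// => j _; exact: sqr_ge0.
Qed.

Lemma sum_integral_sqr_le :
  \sum_(i < n) \int[mu]_(s in D) (f i s ^+ 2) <= fine (mu D).
Proof.
rewrite -lee_fin fineK ?ge0_fin_numE// -sumEFin.
under eq_bigr => i _.
  rewrite /Rintegral fineK; last first.
    by apply: integrable_fin_num => //; exact: unit_ball_integrable_sqr.
  over.
have msq i : measurable_fun D (fun s => (f i s ^+ 2)%:E).
  exact: (measurable_int _ (unit_ball_integrable_sqr i)).
rewrite -ge0_integral_sum//; last by move=> i s _; rewrite lee_fin sqr_ge0.
rewrite -[leRHS]mul1e -integral_cst//.
apply: ge0_le_integral => //.
- by move=> s _; apply: sume_ge0 => i _; rewrite lee_fin sqr_ge0.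
- exact: emeasurable_sum.
- by move=> s Ds; rewrite sumEFin lee_fin f1.
Qed.

(* Jensen's inequality, from [0 <= \int (h * f i - w) ^+ 2 / h] where [h] is the
   mass of [D] and [w] the integral of [f i]. *)
Lemma sqr_Rintegral_le i :
  (\int[mu]_(s in D) f i s) ^+ 2 <= fine (mu D) * \int[mu]_(s in D) (f i s ^+ 2).
Proof.
set h := fine _; set w := Rintegral _ _ _; set q := Rintegral _ _ _.
have h0 : 0 <= h by exact: fine_ge0.
have [h00|hn0] := eqVneq h 0.
  have muD0 : mu D = 0%E by rewrite -[mu D]fineK ?ge0_fin_numE//; congr EFin.
  rewrite h00 mul0r /w /Rintegral null_set_integral ?expr0n//.
  exact/measurable_EFinP.
have {hn0}h0 : 0 < h by rewrite lt_def hn0.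
have ic c : mu.-integrable D (EFin \o cst c).
  apply: measurable_bounded_integrable => //.
  by exists `|c|; split => // M M1 s Ds /=; exact: ltW.
have iZ c (g : T -> R) : mu.-integrable D (EFin \o g) ->
    mu.-integrable D (EFin \o (fun s => c * g s)).
  move=> ig; rewrite (_ : _ \o _ = (fun s => c%:E * (EFin \o g) s)%E).
    exact: integrableZl.
  by apply/funext => s /=; rewrite EFinM.
have ihf2 := iZ h _ (unit_ball_integrable_sqr i).
have iwf := iZ (2 * w) _ (unit_ball_integrable i).
have : 0 <= \int[mu]_(s in D) ((h * f i s ^+ 2 - 2 * w * f i s) + w ^+ 2 / h).
  apply: Rintegral_ge0 => s Ds.
  rewrite (_ : _ + _ = (h * f i s - w) ^+ 2 / h); last by field; rewrite gt_eqF.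
  by rewrite divr_ge0 ?sqr_ge0 ?ltW.
rewrite RintegralD//; last 2 first.
- by under [X in _.-integrable _ X]eq_fun do rewrite /= EFinB; exact: integrableB.
- exact: ic.
rewrite RintegralB// (RintegralZl _ mD (unit_ball_integrable_sqr i)).
rewrite (RintegralZl _ mD (unit_ball_integrable i)).
rewrite Rintegral_cst// -/h -/w -/q divfK ?gt_eqF//; nra.
Qed.

(** The integral of a field with values in the unit ball has Euclidean norm at most the mass of [D]:
    Jensen's inequality is applied in each coordinate and summed. *)
Lemma sum_sqr_Rintegral_le :
  \sum_(i < n) (\int[mu]_(s in D) f i s) ^+ 2 <= fine (mu D) ^+ 2.
Proof.
apply: le_trans (ler_sum _ (fun i _ => sqr_Rintegral_le i)) _.
by rewrite -mulr_sumr expr2 ler_wpM2l ?fine_ge0// sum_integral_sqr_le.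
Qed.

End IntegralUnitBall.

Section Admissible.
Variables (R : realType) (n : nat) (alpha : R -> 'rV[R]_n).
Hypothesis aalpha : admissible alpha.

Lemma admissible_measurable_coord (D : set (lebesgueType R)) (i : 'I_n) :
  measurable D -> D `<=` `[0, +oo[%classic ->
  measurable_fun D (fun s => alpha s ord0 i).
Proof.
move=> mD D0.
have mf : measurable_fun (`[0, +oo[ : set (lebesgueType R))
    ((fun v => v ord0 i) \o (alpha : lebesgueType R -> borelRV R n)).
  exact: (measurableT_comp (measurable_coord i) aalpha.1).
apply: measurable_funS mf => //; exact: measurable_lebesgueType.
Qed.

Lemma admissible_sum_sqr (s : R) :
  0 <= s -> \sum_(i < n) alpha s ord0 i ^+ 2 <= 1.
Proof.
move=> /aalpha.2 a1; rewrite -[leLHS]sqr_sqrtr ?expr_le1 ?sqrtr_ge0//.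
by apply: sumr_ge0 => i _; exact: sqr_ge0.
Qed.

Let sum_sqr_on (D : set R) : D `<=` `[0, +oo[%classic ->
  forall s, D s -> \sum_(i < n) alpha s ord0 i ^+ 2 <= 1.
Proof.
by move=> D0 s /D0 /=; rewrite in_itv/= andbT; exact: admissible_sum_sqr.
Qed.

(** The domain of integration is empty for negative [t] and a null set at 0. *)
Lemma trajectory_le0 x (t : R) : t <= 0 -> trajectory x alpha t = x.
Proof.
rewrite le_eqVlt => /predU1P[->|t0]; apply/rowP => i; rewrite !mxE; last first.
  by rewrite set_itv_ge ?bnd_simp -?ltNge// Rintegral_set0 addr0.
rewrite /Rintegral null_set_integral; first by rewrite addr0.
- exact: measurable_lebesgueType.
- apply/measurable_EFinP; apply: admissible_measurable_coord.
    exact: measurable_lebesgueType.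
  by apply: subset_itvl.
- transitivity (lebesgue_measure (`[0%R, 0%R]%classic : set R)) => //.
  by rewrite set_itv1 lebesgue_measure_set1.
Qed.

Lemma trajectory_diff x (s t : R) (i : 'I_n) : 0 <= s -> s <= t ->
  trajectory x alpha t ord0 i - trajectory x alpha s ord0 i =
  \int[@completed_lebesgue_measure R]_(r in `]s, t]) alpha r ord0 i.
Proof.
move=> s0 st; rewrite !mxE opprD addrACA subrr add0r.
have sub : `[0, t] `<=` `[0, +oo[%classic by apply: subset_itvl.
have -> : `[0, t]%classic = `[0, s]%classic `|` `]s, t]%classic.
  by rewrite -itv_bndbnd_setU ?bnd_simp.
rewrite Rintegral_setU.
- by rewrite addrC addKr.
- exact: measurable_lebesgueType.
- exact: measurable_lebesgueType.
- rewrite -itv_bndbnd_setU ?bnd_simp//.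
  apply: (@unit_ball_integrable _ (lebesgueType R) R _ n _ (fun i s => alpha s ord0 i)).
  + exact: measurable_lebesgueType.
  + rewrite [ltLHS](_ : _ = lebesgue_measure `[0, t]%classic)//.
    by rewrite lebesgue_measure_itv; case: ifPn => //; rewrite ltry.
  + by move=> j; apply: admissible_measurable_coord => //; exact: measurable_lebesgueType.
  + exact: sum_sqr_on.
- apply/disj_setPS => r /= []; rewrite !in_itv/= => /andP[_ rs] /andP[sr _].
  by rewrite ltNge rs in sr.
Qed.

Lemma trajectory_lipschitz_ge0 x (s t : R) : 0 <= s -> s <= t ->
  \sum_(i < n) (trajectory x alpha t ord0 i - trajectory x alpha s ord0 i) ^+ 2
  <= (t - s) ^+ 2.
Proof.
move=> s0 st; have sub : `]s, t] `<=` `[0, +oo[%classic.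
  by move=> r /=; rewrite !in_itv/= andbT => /andP[/ltW /(le_trans s0)].
have mst : completed_lebesgue_measure `]s, t]%classic = (t - s)%:E.
  transitivity (lebesgue_measure (`]s, t]%classic : set R)) => //.
  rewrite lebesgue_measure_itv/= lte_fin.
  by move: st; rewrite le_eqVlt => /predU1P[->|->//]; rewrite ltxx subrr.
under eq_bigr do rewrite trajectory_diff//.
have := @sum_sqr_Rintegral_le _ (lebesgueType R) R completed_lebesgue_measure n
  `]s, t]%classic (fun i s => alpha s ord0 i).
have <- : fine (completed_lebesgue_measure `]s, t]%classic) = t - s by rewrite mst.
apply.
- exact: measurable_lebesgueType.
- exact: (eq_ind_r (fun z => z < +oo)%E (ltry _) mst).
- by move=> j; apply: admissible_measurable_coord => //; exact: measurable_lebesgueType.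
- exact: sum_sqr_on.
Qed.

Lemma lipschitz1_path_of_trajectory x : lipschitz1_path (trajectory x alpha).
Proof.
(* Negative times reduce to the nonnegative case because [t |-> max t 0] is itself 1-Lipschitz. *)
have tmax t : trajectory x alpha t = trajectory x alpha (Num.max t 0).
  by case: leP => // t0; rewrite !trajectory_le0// ltW.
move=> s t; wlog st : s t / s <= t.
  move=> H; have [/H//|/ltW /H ts] := leP s t.
  by rewrite -sqrrN opprB; under eq_bigr do rewrite -sqrrN opprB.
rewrite (tmax s) (tmax t); apply: (le_trans (trajectory_lipschitz_ge0 _ _ _)).
- by rewrite le_max lexx orbT.
- by rewrite ge_max !le_max st lexx orbT.
rewrite ler_sqr ?nnegrE ?subr_ge0//; last by rewrite ge_max !le_max st lexx orbT.
by case: (leP s 0); case: (leP t 0) => //; lra.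
Qed.
End Admissible.

(** * Compactness of Lipschitz paths *)

Lemma lipschitz1_path_norm (R : realType) (n : nat) (y : R -> 'rV[R]_n) :
  lipschitz1_path y -> forall s t, `|y s - y t| <= `|s - t|.
Proof.
move=> y1 s t; rewrite [leLHS]/Num.norm/= mx_normrE bigmax_le// => -[j i] _ /=.
by rewrite !mxE (ord1 j) lipschitz1_path_coord.
Qed.

Lemma lipschitz1_path_limit (R : realType) (n : nat) (y_ : nat -> R -> 'rV[R]_n)
    (y : R -> 'rV[R]_n) (phi : nat -> nat) (s t : R) :
  (forall k, lipschitz1_path (y_ k)) ->
  y_ (phi k) s @[k --> \oo] --> y s -> y_ (phi k) t @[k --> \oo] --> y t ->
  \sum_(i < n) (y t ord0 i - y s ord0 i) ^+ 2 <= (t - s) ^+ 2.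
Proof.
move=> y1 ys yt.
have : \sum_(i < n) (y_ (phi k) t ord0 i - y_ (phi k) s ord0 i) ^+ 2 @[k --> \oo]
    --> \sum_(i < n) (y t ord0 i - y s ord0 i) ^+ 2.
  apply: cvg_sum_sqr => i; apply: cvgB.
    exact: (cvg_comp _ _ yt (@coord_continuous _ _ _ ord0 i _)).
  exact: (cvg_comp _ _ ys (@coord_continuous _ _ _ ord0 i _)).
by move=> /cvgr_to_le; apply; near=> k; exact: y1.
Unshelve. all: by end_near. Qed.

Lemma nbhs_norm_lt (R : realType) (n : nat) (v : 'rV[R]_n) (e : R) :
  0 < e -> nbhs v [set w | `|v - w| < e].
Proof.
by move=> e0; apply/nbhs_ballP; exists e => //= w; rewrite -ball_normE.
Qed.

(* [y] is a cluster point of [y_] for pointwise convergence. *)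
Lemma lipschitz1_path_compact (R : realType) (n : nat) (x : 'rV[R]_n)
    (y_ : nat -> R -> 'rV[R]_n) :
  (forall k, lipschitz1_path (y_ k)) -> (forall k, y_ k 0 = x) ->
  exists y : R -> 'rV[R]_n, forall (l : seq R) (m : nat),
    exists2 k, (m <= k)%N & forall p, p \in l -> `|y p - y_ k p| < m.+1%:R^-1.
Proof.
move=> y1 y0.
(* At time [t], a 1-Lipschitz path issued from [x] lies in this compact box. *)
pose K (t : R) := [set v : 'rV[R]_n | forall i,
  `[x ord0 i - `|t|, x ord0 i + `|t|]%classic (v ord0 i)].
have cK t : compact (K t).
  apply: (@rV_compact _ n (fun i => `[x ord0 i - `|t|, x ord0 i + `|t|]%classic)).
  by move=> i; exact: segment_compact.
pose F : set_system (prod_topology (fun _ : R => 'rV[R]_n)) := y_ @ \oo.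
have FK : F [set f | forall t, K t (f t)].
  exists 0%N => // k _ t i /=; rewrite in_itv/= -ler_distl -(y0 k).
  by rewrite (le_trans (lipschitz1_path_coord (y1 k) _ _ _))// subr0.
have [y [_ clFy]] := tychonoff cK (_ : ProperFilter F) FK.
exists y => l m.
(* A cluster point meets both the tail [A] of the sequence and the neighbourhood [B], which
   constrains finitely many times. *)
pose A : set (prod_topology (fun _ : R => 'rV[R]_n)) :=
  [set y_ k | k in [set k | (m <= k)%N]].
pose B : set (prod_topology (fun _ : R => 'rV[R]_n)) :=
  [set f | forall p, p \in l -> `|y p - f p| < m.+1%:R^-1].
have FA : F A by exists m => // k mk; exists k.
have yB : nbhs y B.
  rewrite /B; elim: l {B} => [|q l IH]; first exact: filterS filterT.
  have : nbhs y [set f | `|y q - f q| < m.+1%:R^-1].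
    have e0 : 0 < m.+1%:R^-1 :> R by rewrite invr_gt0.
    exact: (@proj_continuous R (fun=> 'rV[R]_n) q y _ (nbhs_norm_lt (y q) e0)).
  apply: filterS2 IH => f fl fq p; rewrite inE => /predU1P[->//|]; exact: fl.
by have [_ [[k /= mk <-] yBk]] := clFy A B FA yB; exists k.
Unshelve. all: by end_near. Qed.

(** A cluster point in an uncountable product need not be the limit of a subsequence. Indices are
    therefore chosen to converge at rational times, and the common Lipschitz bound extends this to
    all times. Only [m <= phi m] is asked, not monotonicity. *)
Lemma lipschitz1_path_subsequence (R : realType) (n : nat) (x : 'rV[R]_n)
    (y_ : nat -> R -> 'rV[R]_n) :
  (forall k, lipschitz1_path (y_ k)) -> (forall k, y_ k 0 = x) ->
  exists y : R -> 'rV[R]_n, exists phi : nat -> nat,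
    [/\ lipschitz1_path y, forall m, (m <= phi m)%N
      & forall t, y_ (phi m) t @[m --> \oo] --> y t].
Proof.
move=> y1 y0; have [y yP] := lipschitz1_path_compact y1 y0.
have yl (l : nat -> seq R) : exists2 phi : nat -> nat, (forall m, (m <= phi m)%N) &
    forall m p, p \in l m -> `|y p - y_ (phi m) p| < m.+1%:R^-1.
  have H m : exists k, (m <= k)%N /\ forall p, p \in l m -> `|y p - y_ k p| < m.+1%:R^-1.
    by have [k mk kP] := yP (l m) m; exists k.
  have [phi phiP] := choice H.
  by exists phi => m; have [] := phiP m.
(* Each pair of times gets its own sequence of indices. *)
have ylip : lipschitz1_path y.
  move=> s t; have [phi _ phiP] := yl (fun=> [:: s; t]).
  have cv p : p \in [:: s; t] -> y_ (phi m) p @[m --> \oo] --> y p.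
    move=> pst; apply/cvgrPdist_lt => e e0; near=> m.
    apply: (lt_trans (phiP m p pst)); near: m.
    exact: (near_infty_natSinv_lt (PosNum e0)).
  by apply: (lipschitz1_path_limit (phi := phi) y1); apply: cv; rewrite !inE eqxx ?orbT.
(* The rationals with code below [m]: finite lists that eventually contain any given rational. *)
pose grid m : seq R := [seq ratr q | q <- pmap (@unpickle rat) (iota 0 m)].
have [phi mphi phiP] := yl grid.
exists y, phi; split => // t; apply/cvgrPdist_lt => e e0.
have e3 : 0 < e / 3 by rewrite divr_gt0.
have [q] : exists q : rat, ratr q \in `]t - e / 3, t + e / 3[.
  by apply: rat_in_itvoo; lra.
rewrite in_itv/= -ltr_distl => qt.
near=> m.
have qm : `|y (ratr q) - y_ (phi m) (ratr q)| < e / 3.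
  apply: lt_trans (phiP m _ _) _.
    apply: map_f; rewrite mem_pmap; apply/mapP; exists (pickle q); last by rewrite pickleK.
    by rewrite mem_iota/= add0n; near: m; exact: nbhs_infty_gt.
  near: m; exact: (near_infty_natSinv_lt (PosNum e3)).
apply: le_lt_trans (ler_distD (y (ratr q)) _ _) _.
have := lipschitz1_path_norm ylip t (ratr q).
have := ler_distD (y_ (phi m) (ratr q)) (y (ratr q)) (y_ (phi m) t).
have := lipschitz1_path_norm (y1 (phi m)) (ratr q) t.
rewrite [`|t - _|]distrC; lra.
Unshelve. all: by end_near. Qed.

(** * Lower semicontinuity of the cost *)

Lemma limn_einf_ge0 (R : realType) (u : (\bar R)^nat) :
  (forall k, 0 <= u k)%E -> (0 <= limn_einf u)%E.
Proof.
move=> u0; rewrite limn_einf_lim; apply: lime_ge; first exact: is_cvg_einfs.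
by apply: nearW => k; apply/le_ereal_inf_tmp => _ [m _ <-].
Qed.

Lemma limn_einf_le (R : realType) (u : (\bar R)^nat) (v : \bar R) :
  (forall k, u k <= v + (k.+1%:R^-1)%:E)%E -> (limn_einf u <= v)%E.
Proof.
move=> uv; rewrite limn_einf_lim; apply: lime_le; first exact: is_cvg_einfs.
apply: nearW => k; apply/lee_addgt0Pr => e e0.
near \oo => m.
apply: (@le_trans _ _ (u m)).
  by apply: ereal_inf_lbound; exists m => //=; near: m; exact: nbhs_infty_ge.
apply: (le_trans (uv m)); rewrite leeD2l// lee_fin ltW//; near: m.
exact: (near_infty_natSinv_lt (PosNum e0)).
Unshelve. all: by end_near. Qed.

Lemma integral_le_limn_einf d (T : measurableType d) (R : realType)
    (mu : {measure set T -> \bar R}) (f : T -> \bar R) (f_ : (T -> \bar R)^nat) :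
  measurable_fun setT f -> (forall m, measurable_fun setT (f_ m)) ->
  (forall s, 0 <= f s)%E -> (forall m s, 0 <= f_ m s)%E ->
  (forall s, f s <= limn_einf (f_ ^~ s))%E ->
  (\int[mu]_s f s <= limn_einf (fun m => \int[mu]_s f_ m s))%E.
Proof.
move=> mf mf_ f0 f_0 ff_; apply: le_trans (fatou _ _ mf_ _) => //.
apply: ge0_le_integral => //.
(* Measurability of the lower limit is obtained from that of the upper limit of the opposites. *)
rewrite (_ : (fun x => _) = (fun x => - limn_esup (-%E \o f_^~ x))%E); last first.
  by apply/funext => s; rewrite limn_esupN oppeK.
apply: measurableT_comp => //; apply: (measurable_fun_limn_esup (f := fun m x => - f_ m x)%E).
by move=> m; exact: measurableT_comp.
Qed.

Section PathCost.
Context (R : realType) (n : nat) (M : set 'rV[R]_n) (ell : 'rV[R]_n -> R).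
Hypotheses (M_closed : closed M) (ell_continuous : continuous ell)
  (ell_ge0 : forall x, 0 <= ell x) (ell_zero : forall x, M x -> ell x = 0).
Implicit Types (y : R -> 'rV[R]_n).

(** This and the next two definitions restate the hitting time and the cost for an arbitrary path,
    so that the limit path can be handled before its control is known. At [trajectory x alpha] they
    unfold to the original notions. *)
Definition path_hitting_time y : \bar R :=
  ereal_inf [set s%:E | s in [set s : R | 0 <= s /\ M (y s)]].

Definition path_domain y : set R :=
  [set s : R | (0 <= s)%R /\ (s%:E <= path_hitting_time y)%E].

Definition path_cost y : \bar R :=
  (\int[@completed_lebesgue_measure R]_(s in path_domain y) (ell (y s))%:E)%E.

Lemma path_domain_measurable y :
  measurable (path_domain y : set (measurableTypeR R)).
Proof.
rewrite /path_domain; case: path_hitting_time => [r| |].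
- rewrite (_ : [set s | _] = `[0, r]%classic)//.
  by apply/seteqP; split=> s /=; rewrite in_itv/= lee_fin => /andP.
- rewrite (_ : [set s | _] = `[0, +oo[%classic)//.
  by apply/seteqP; split=> s /=; rewrite in_itv/= andbT leey => // -[].
- rewrite (_ : [set s | _] = set0)//.
  by apply/seteqP; split=> s //= -[_]; rewrite leeNy_eq.
Qed.

(** Extension by 0 puts all costs on the same domain, as Fatou's lemma requires. *)
Let integrand y : R -> \bar R := (fun s => (ell (y s))%:E) \_ (path_domain y).

Lemma measurable_integrand y : continuous y ->
  measurable_fun setT (integrand y : lebesgueType R -> \bar R).
Proof.
move=> cy; apply: measurable_fun_lebesgueType => //.
apply/(measurable_restrictT _ (path_domain_measurable y)).
apply/measurable_EFinP; apply: measurable_funTS; apply: continuous_measurable_fun.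
by move=> s; apply: continuous_comp; [exact: cy|exact: ell_continuous].
Qed.

Lemma integrand_ge0 y s : (0 <= integrand y s)%E.
Proof. by rewrite /integrand patchE; case: ifP => // _; rewrite lee_fin. Qed.

Lemma path_cost_integrand y :
  path_cost y = (\int[@completed_lebesgue_measure R]_s integrand y s)%E.
Proof. by rewrite /path_cost integral_mkcond. Qed.

Lemma lipschitz1_path_continuous y : lipschitz1_path y -> continuous y.
Proof.
move=> y1 s; apply/cvgrPdist_le => e e0; near=> t.
by rewrite (le_trans (lipschitz1_path_norm y1 _ _))//; near: t; exact: cvgr_dist_le.
Unshelve. all: by end_near. Qed.

Section Limit.
Variables (y : R -> 'rV[R]_n) (y_ : nat -> R -> 'rV[R]_n).
Hypotheses (y1 : lipschitz1_path y) (y_1 : forall m, lipschitz1_path (y_ m))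
  (y_y : forall t, y_ m t @[m --> \oo] --> y t).

(** Lower semicontinuity of the hitting time: the complement of [M] is open, and the common
    Lipschitz bound with compactness of [[0, s]] makes the avoidance uniform in time. *)
Lemma near_path_domain (s : R) : 0 <= s ->
  (forall r : R, 0 <= r <= s -> ~ M (y r)) -> \forall m \near \oo, path_domain (y_ m) s.
Proof.
move=> s0 nM.
have H : \forall m \near \oo, `[0, s]%classic `<=` (fun r => ~ M (y_ m r)).
  have /compact_near_coveringP cpt := @segment_compact R 0 s.
  apply: (cpt _ _ (fun m r => ~ M (y_ m r))) => r /=; rewrite in_itv/= => rs.
  have [e /= e0 eM] : nbhs_ball (y r) (~` M).
    apply/nbhs_ballP/open_nbhs_nbhs; split; [exact: closed_openC|exact: nM].
  have e2 : 0 < e / 2 by rewrite divr_gt0.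
  have yr : \forall m \near \oo, `|y r - y_ m r| < e / 2.
    by move/cvgrPdist_lt : (@y_y r); apply.
  have rr : \forall r' \near r, `|r - r'| < e / 2.
    by apply/nbhs_ballP; exists (e / 2) => // z; rewrite -ball_normE.
  (* Moving from [r'] to [r] costs less than [e / 2] for every [y_ m], and passing to [y r] the
     other half. *)
  near=> r' m.
  apply: eM; rewrite -ball_normE /=.
  apply: le_lt_trans (ler_distD (y_ m r) _ _) _.
  rewrite [e]splitr ltrD//.
    by near: m; exact: yr.
  apply: le_lt_trans (lipschitz1_path_norm (y_1 m) _ _) _.
  by near: r'; exact: rr.
apply: filterS H => m mM; split => //.
apply/le_ereal_inf_tmp => _ [r [r0 Mr] <-]; rewrite lee_fin leNgt.
apply/negP => rs; apply: (mM r) => //=; by rewrite in_itv/= r0 ltW.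
Unshelve. all: by end_near. Qed.

Lemma integrand_le_limn_einf s :
  (integrand y s <= limn_einf (fun m => integrand (y_ m) s))%E.
Proof.
have l0 : (0 <= limn_einf (fun m => integrand (y_ m) s))%E.
  by apply: limn_einf_ge0 => m; exact: integrand_ge0.
rewrite {1}/integrand patchE; case: ifPn => // /set_mem[s0 sT].
(* If [y] meets [M] by time [s], it does so exactly at [s], where [ell] vanishes. Otherwise [s] is
   eventually in the domains of the [y_ m], and the integrands converge by continuity. *)
have [[r [/andP[r0 rs] Mr]]|nM] := pselect (exists r, 0 <= r <= s /\ M (y r)).
  suff rsE : r = s by rewrite -[in leLHS]rsE ell_zero.
  apply/eqP; rewrite eq_le rs -lee_fin (le_trans sT)//.
  by apply: ereal_inf_lbound; exists r.
have dom : \forall m \near \oo, path_domain (y_ m) s.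
  by apply: near_path_domain => // r rs Mr; apply: nM; exists r.
rewrite (cvg_limn_einf_sup (l := (ell (y s))%:E) _).1//.
apply: (@cvg_trans _ ((ell (y_ m s))%:E @[m --> \oo])).
  apply: near_eq_cvg; near=> m; rewrite /integrand patchE mem_set//.
  by near: m.
apply: cvg_EFin; first exact: nearW.
apply: (cvg_comp (fun m => y_ m s) ell); first exact: y_y.
exact: ell_continuous.
Unshelve. all: by end_near. Qed.

Lemma path_cost_le_limn_einf :
  (path_cost y <= limn_einf (fun m => path_cost (y_ m)))%E.
Proof.
rewrite path_cost_integrand.
rewrite (_ : (fun m => path_cost (y_ m)) = (fun m =>
    \int[@completed_lebesgue_measure R]_s integrand (y_ m) s)%E); last first.
  by apply/funext => m; exact: path_cost_integrand.
apply: integral_le_limn_einf.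
- by apply: measurable_integrand; exact: lipschitz1_path_continuous.
- by move=> m; apply: measurable_integrand; exact: lipschitz1_path_continuous.
- by move=> s; exact: integrand_ge0.
- by move=> m s; exact: integrand_ge0.
- exact: integrand_le_limn_einf.
Qed.
End Limit.
End PathCost.

(** * Existence of an optimal control *)

Lemma path_cost_eq (R : realType) (n : nat) (M : set 'rV[R]_n) (ell : 'rV[R]_n -> R)
    (y z : R -> 'rV[R]_n) :
  (forall t : R, 0 <= t -> y t = z t) -> path_cost M ell y = path_cost M ell z.
Proof.
move=> yz; have hE : path_hitting_time M y = path_hitting_time M z.
  by congr (ereal_inf (image _ _)); apply/seteqP; split=> s /= [s0]; rewrite yz.
rewrite /path_cost /path_domain hE; apply: eq_integral => s /set_mem[s0 _].
by rewrite yz.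
Qed.

Theorem theorem3p1 (R : realType) (n : nat)
    (M : set 'rV[R]_n) (ell : 'rV[R]_n -> R)
    (M_nonempty : M !=set0) (M_closed : closed M)
    (ell_continuous : continuous ell)
    (ell_bounded : bounded_fun (ell : 'rV[R]_n -> R^o))
    (ell_pos : forall x, ~ M x -> 0 < ell x)
    (ell_zero : forall x, M x -> ell x = 0)
    (x : 'rV[R]_n) :
  exists alpha : R -> 'rV[R]_n,
    admissible alpha /\ cost M ell x alpha = value M ell x.
Proof.
have ell_ge0 z : 0 <= ell z.
  by have [/ell_zero->//|/ell_pos/ltW] := pselect (M z).
have cost_ge alpha : admissible alpha -> (value M ell x <= cost M ell x alpha)%E.
  by move=> aalpha; apply: ereal_inf_lbound; exists alpha.
have value_ge0 : (0 <= value M ell x)%E.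
  apply/le_ereal_inf_tmp => _ [alpha _ <-]; apply: integral_ge0 => s _.
  by rewrite lee_fin.
(* If the value is infinite, every admissible control attains it; the velocity of the constant path
   is one. *)
have [vy|vNy] := eqVneq (value M ell x) +oo%E.
  have x1 : lipschitz1_path (fun _ : R => x).
    by move=> s t; rewrite big1 ?sqr_ge0// => i _; rewrite subrr expr0n.
  have [a0 _] := lipschitz1_path_trajectory x1.
  exists (path_velocity (fun=> x)); split => //.
  by apply/eqP; rewrite eq_le cost_ge// vy leey.
have vfin : value M ell x \is a fin_num by rewrite ge0_fin_numE// lt_neqAle vNy leey.
have /choice[alpha_ alphaP] k : exists alpha, admissible alpha /\
    (cost M ell x alpha <= value M ell x + (k.+1%:R^-1)%:E)%E.
  have k0 : 0 < k.+1%:R^-1 :> R by rewrite invr_gt0.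
  have [_ [alpha aalpha <-] /ltW calpha] := lb_ereal_inf_adherent k0 vfin.
  by exists alpha.
have [y [phi [y1 phi_ge y_y]]] := lipschitz1_path_subsequence
  (fun k => lipschitz1_path_of_trajectory (alphaP k).1 x)
  (fun k => trajectory_le0 (alphaP k).1 x (lexx 0)).
have yx : y 0 = x.
  apply: (cvg_unique _ (y_y 0)) => //.
  rewrite /= (_ : (fun m => _) = cst x); first exact: cvg_cst.
  by apply/funext => m; rewrite trajectory_le0//; exact: (alphaP (phi m)).1.
have [av vy] := lipschitz1_path_trajectory y1.
exists (path_velocity y); split => //; apply/eqP; rewrite eq_le cost_ge// andbT.
(* The trajectory agrees with [y] at nonnegative times, the only ones that enter the cost. *)
have -> : cost M ell x (path_velocity y) = path_cost M ell y.
  by apply: path_cost_eq => t t0; rewrite -[in RHS]vy// yx.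
apply: le_trans (path_cost_le_limn_einf M_closed ell_continuous ell_ge0 ell_zero y1
  (fun m => lipschitz1_path_of_trajectory (alphaP (phi m)).1 x) y_y) _.
apply: limn_einf_le => k; apply: le_trans (alphaP (phi k)).2 _.
(* The error [1 / (phi k + 1)] is at most [1 / (k + 1)] because [k <= phi k]. *)
by rewrite leeD2l// lee_fin lef_pV2 ?posrE// ler_nat ltnS phi_ge.
Qed.
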